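(* Let $X$ be a four dimensional real vector space with a Euclidean structure and an orthonormal basis $e_1,e_2,e_3,e_4$, and equip $X$ with the norm $\|\cdot\|$ that is the Minkowski functional of the convex symmetric set $$\mathcal C=\Bigl\{\sum_{i=1}^4 y_ie_i\in X : \Bigl|\tfrac{y_1+y_3}{\sqrt2}\Bigr|+\Bigl|\tfrac{y_2-y_4}{\sqrt2}\Bigr|+\Bigl|\tfrac{y_1-y_2-y_3-y_4}{2}\Bigr|+\Bigl|\tfrac{y_1+y_2-y_3+y_4}{2}\Bigr|\le 1\Bigr\}.$$ Let $\mathcal H^2_{\|\cdot\|}$ be the two dimensional Hausdorff measure on $X$ induced by the norm $\|\cdot\|$. Then there is no linear contraction of $\mathcal H^2_{\|\cdot\|}$ onto the plane $\mathrm{span}(e_1,e_2)$.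
   Context: A linear contraction of $\mathcal H^2_{\|\cdot\|}$ onto a two dimensional linear subspace $W\subset X$ is a linear projection $\pi:X\to X$ with range $W$ (that is, $\pi\circ\pi=\pi$ and $\pi(X)=W$) that does not increase $\mathcal H^2_{\|\cdot\|}$, i.e. $\mathcal H^2_{\|\cdot\|}(\pi(A))\le \mathcal H^2_{\|\cdot\|}(A)$ for every two dimensional linear subspace $V\subset X$ and every two dimensional Euclidean disc $A\subset V$. *)

(* Defs.v *)
From mathcomp Require Export all_boot all_order all_algebra sesquilinear.
From mathcomp Require Export all_classical all_reals all_analysis.

Set Implicit Arguments.
Unset Strict Implicit.
Unset Printing Implicit Defensive.

Import Order.TTheory GRing.Theory Num.Theory.

Local Open Scope classical_set_scope.
Local Open Scope ring_scope.

Definition minkowski_functional {R : realType} {X : lmodType R} (C : set X)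
    (x : X) : R :=
  inf [set t : R | 0 < t /\ exists2 y, C y & x = t *: y].

Section hausdorff.
Context {R : realType} {X : zmodType} (N : X -> R).
Local Open Scope ereal_scope.

(* Adjoining 0 gives the empty set diameter 0 instead of -oo. *)
Definition ndiam (S : set X) : \bar R :=
  ereal_sup [set d | d = 0 \/
    exists x y, [/\ S x, S y & d = (N (x - y))%:E]].

(* The factor pi / 4 is alpha(2) / 2^2, with alpha(2) = pi the area of the
   Euclidean unit disc. *)
Definition hausdorff2_delta (delta : R) (A : set X) : \bar R :=
  ereal_inf [set \sum_(0 <= k <oo) (pi / 4)%:E * ndiam (S k) ^+ 2 |
    S in [set S : nat -> set X |
      A `<=` \bigcup_k S k /\ forall k, ndiam (S k) <= delta%:E]].

(* N is the norm: no topology on X is used, the metric is N (x - y). *)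
Definition hausdorff2 (A : set X) : \bar R :=
  ereal_sup [set hausdorff2_delta delta A | delta in [set d : R | (0 < d)%R]].

End hausdorff.

Section contraction.
Context {R : realType} {X : vectType R}.

Definition euclidean_disc (ip : {dot X for idfun}) (V : {vspace X})
    (A : set X) : Prop :=
  exists (c : X) (r : R), [/\ c \in V, 0 < r &
    A = [set x | x \in V /\ ip (x - c) (x - c) <= r ^+ 2]].

Definition linear_contraction (ip : {dot X for idfun}) (N : X -> R)
    (W : {vspace X}) (p : 'End(X)) : Prop :=
  [/\ (p \o p)%VF = p, limg p = W &
    forall V : {vspace X}, \dim V = 2%N ->
    forall A : set X, euclidean_disc ip V A ->
      (hausdorff2 N (p @` A) <= hausdorff2 N A)%E].

End contraction.

(* The indices are shifted: e`_0, ..., e`_3 are e_1, ..., e_4. *)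
Definition crosspolytope {R : realType} {X : vectType R} (e : 4.-tuple X) :
    set X :=
  [set x | exists y : 'I_4 -> R, x = \sum_(i < 4) y i *: e`_i /\
    let y1 := y (inord 0) in let y2 := y (inord 1) in
    let y3 := y (inord 2) in let y4 := y (inord 3) in
    `|(y1 + y3) / Num.sqrt 2| + `|(y2 - y4) / Num.sqrt 2|
    + `|(y1 - y2 - y3 - y4) / 2| + `|(y1 + y2 - y3 + y4) / 2| <= 1].

(* Main.v *)
Require Import Defs.
From mathcomp Require Import ring lra measurable_realfun.

(** The norm N is the l^1 norm of four orthonormal functionals f1, ..., f4, and
    its unit ball in W = span(e1, e2) is a regular octagon.  Covering by small
    translates of a tile bounds the Hausdorff measure of a plane from above by a
    multiple of Lebesgue measure; in W the isodiametric inequality for the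
    octagonal norm bounds it from below by the multiple pi / |octagon|.  So if a
    plane V = span(v1, v2) is covered by the translates of the unit ball of N by
    Z v1 + Z v2, a contraction p onto W satisfies
    |det (p v1, p v2)| <= 12 sqrt 2 - 16, the area of the octagon in W.

    Write p e3 = a e1 + c e2 and p e4 = b e1 + d e2.  The two planes spanned by
    pairs of coordinate axes of l^1, namely {f1, f2} and {f3, f4}, force
    a d - b c >= 17 - 12 sqrt 2.  Four planes on each of which one functional
    vanishes and the unit ball is a hexagon, permuted by the symmetry of order 8
    of the l^1 ball that preserves W, force |a + d| + |c - b| <= 1 / 5, whence
    a d - b c <= 1 / 100, a contradiction. *)

Set Implicit Arguments.
Unset Strict Implicit.
Unset Printing Implicit Defensive.

Import Order.TTheory GRing.Theory Num.Theory numFieldNormedType.Exports.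

Local Open Scope classical_set_scope.
Local Open Scope ring_scope.

(** * Area in the plane *)

(** Bundles the push-forward as a measure, the form that the uniqueness theorems for Lebesgue and
    product measures take. *)
Lemma preimage_measure d d' (T : measurableType d) (T' : measurableType d')
    (R : realType) (mu : {measure set T -> \bar R}) (f : T -> T') :
  measurable_fun setT f ->
  exists nu : {measure set T' -> \bar R}, forall A, nu A = mu (f @^-1` A).
Proof.
move=> mf.
by exists (measure_function_pushforward__canonical__measure_function_Measure mu mf).
Qed.

(** [|k|] times the push-forward under [y -> k y + c] agrees with Lebesgue measure on half-open
    intervals, hence on all measurable sets by uniqueness. *)
Lemma lebesgue_measure_affine {R : realType} (k c : R) (S : set R) :
  k != 0 -> measurable S ->
  (lebesgue_measure [set y | S (k * y + c)%R] =
   (`|k|^-1)%:E * lebesgue_measure S)%E.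
Proof.
move=> k0 mS.
pose f : measurableTypeR R -> measurableTypeR R := fun y => k * y + c.
have mf : measurable_fun setT f.
  by apply: measurable_funD => //; exact: measurable_funM.
have [nu nuE] := preimage_measure lebesgue_measure mf.
have H : forall X, ocitv X -> lebesgue_measure X = mscale (NngNum (normr_ge0 k)) nu X.
  move=> _ [[a b] _ <-] /=.
  rewrite /mscale /= nuE.
  have [ab|ab] := ltP a b; last first.
    rewrite set_itv_ge ?preimage_set0 ?measure0 ?mule0//.
    by rewrite bnd_simp -leNgt.
  rewrite lebesgue_measure_itv/= lte_fin ab.
  have [kp|kn] : 0 < k \/ k < 0 by case: (ltgtP k 0) k0 => //; [right|left].
  - rewrite (_ : f @^-1` _ = `](a - c) / k, (b - c) / k]%classic); last first.
      apply/seteqP; split => y /=; rewrite !in_itv/= /f ltr_pdivrMr// ler_pdivlMr//;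
        by move=> /andP[? ?]; apply/andP; split; lra.
    rewrite lebesgue_measure_itv/= lte_fin ltr_pM2r ?invr_gt0// ltrD2r ab.
    by rewrite gtr0_norm// -!EFinD -EFinM; congr (_%:E); field.
  - rewrite (_ : f @^-1` _ = `[(b - c) / k, (a - c) / k[%classic); last first.
      apply/seteqP; split => y /=; rewrite !in_itv/= /f ltr_ndivlMr// ler_ndivrMr//;
        by move=> /andP[? ?]; apply/andP; split; lra.
    rewrite lebesgue_measure_itv/= lte_fin ltr_nM2r ?invr_lt0// ltrD2r ab.
    by rewrite ltr0_norm// -!EFinD -EFinM; congr (_%:E); field.
have -> : lebesgue_measure S = (`|k|%:E * nu S)%E := lebesgue_measure_unique H mS.
rewrite nuE muleA -EFinM.
by rewrite mulVf ?normr_eq0// mul1e.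
Qed.

Local Notation area := (lebesgue_measure \x lebesgue_measure)%E.

Section area.
Context {R : realType}.
Local Notation leb := (@lebesgue_measure R).
Local Notation T2 := (measurableTypeR R * measurableTypeR R)%type.
Implicit Type S : set T2.

Lemma area_swap S : measurable S ->
  area [set z : T2 | S (z.2, z.1)] = (leb \x leb)%E S.
Proof.
move=> mS.
have mf : measurable_fun setT (fun z : T2 => (z.2, z.1)).
  by apply: measurable_fun_pair.
have [nu nuE] := preimage_measure (leb \x leb)%E mf.
have -> : (leb \x leb)%E S = nu S; last by rewrite nuE.
apply: product_measure_unique => // A1 A2 mA1 mA2.
rewrite nuE (_ : _ @^-1` _ = A2 `*` A1).
  transitivity ((leb \x leb)%E (A2 `*` A1)) => //.
  by rewrite muleC; exact: product_measure1E.
by apply/seteqP; split => -[x y] [].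
Qed.

(** On each vertical fibre the map is affine of slope [k]; the one-dimensional formula is integrated
    over the base. *)
Lemma area_fiber_affine (k : R) (f : R -> R) S : k != 0 ->
  measurable S ->
  (area [set z : T2 | S (z.1, k * z.2 + f z.1)%R] =
   (`|k|^-1)%:E * (leb \x leb) S)%E.
Proof.
move=> k0 mS.
rewrite /product_measure1 -ge0_integralZl//; last first.
  exact: measurable_fun_xsection.
apply: eq_integral => x _ /=.
by rewrite -(@lebesgue_measure_affine R k (f x))//; exact: measurable_xsection.
Qed.

Lemma measurable_lin (a b c : R) :
  measurable_fun setT (fun z : T2 => a * z.1 + b * z.2 + c).
Proof.
by apply: measurable_funD => //; apply: measurable_funD; apply: measurable_funM.
Qed.

Lemma measurable_preimage_lin (a b c d : R) S : measurable S ->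
  measurable [set z : T2 | S (a * z.1 + b * z.2, c * z.1 + d * z.2)].
Proof.
move=> mS; rewrite -[X in measurable X]setTI.
have := measurable_fun_pair (measurable_lin a b 0) (measurable_lin c d 0).
move=> /(_ measurableT S mS).
by congr measurable; apply/seteqP; split => z /=; rewrite !addr0.
Qed.

(** For [b != 0] the map is composed of two fibrewise affine maps, of slopes [b] and [c - d a / b],
    with a swap of coordinates between them; the product of the slopes is minus the determinant. For
    [b = 0] exchanging the two output coordinates leads back to this case. *)
Lemma area_lin (a b c d : R) S : a * d - b * c != 0 -> measurable S ->
  (area [set z : T2 | S (a * z.1 + b * z.2, c * z.1 + d * z.2)%R] =
   (`|a * d - b * c|^-1)%:E * (leb \x leb) S)%E.
Proof.
have H (a' b' c' d' : R) (S' : set T2) : b' != 0 -> a' * d' - b' * c' != 0 ->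
    measurable S' ->
    (area [set z : T2 | S' (a' * z.1 + b' * z.2, c' * z.1 + d' * z.2)%R] =
     (`|a' * d' - b' * c'|^-1)%:E * (leb \x leb) S')%E.
  move=> b0 D0 mS.
  pose S1 := [set z : T2 | S' (z.1, (c' - d' * a' / b') * z.2 + d' / b' * z.1)].
  pose S2 := [set z : T2 | S1 (z.2, z.1)].
  have mS1 : measurable S1.
    rewrite (_ : S1 = [set z : T2 |
      S' (1 * z.1 + 0 * z.2, d' / b' * z.1 + (c' - d' * a' / b') * z.2)]).
      exact: measurable_preimage_lin.
    by apply/seteqP; split => z /=; rewrite mul1r mul0r addr0 addrC.
  have mS2 : measurable S2.
    rewrite (_ : S2 = [set z : T2 | S1 (0 * z.1 + 1 * z.2, 1 * z.1 + 0 * z.2)]).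
      exact: measurable_preimage_lin.
    by apply/seteqP; split => z /=; rewrite !mul1r !mul0r addr0 add0r.
  have k0 : c' - d' * a' / b' != 0.
    apply: contra D0 => /eqP e; apply/eqP.
    have -> : a' * d' - b' * c' = - b' * (c' - d' * a' / b') by field.
    by rewrite e mulr0.
  rewrite (_ : [set z : T2 | S' _] = [set z : T2 | S2 (z.1, b' * z.2 + a' * z.1)]).
    rewrite (@area_fiber_affine b' (fun x => a' * x))// area_swap//.
    rewrite (@area_fiber_affine _ (fun x => d' / b' * x))// muleA -EFinM.
    congr (_%:E * _)%E; rewrite -invfM -normrM -[in RHS]normrN; congr (`|_|^-1).
    by field.
  apply/seteqP; split => -[x y]; rewrite /S2 /S1 /=;
    by congr S'; congr pair; field.
move=> D0 mS.
have [b0|b0] := eqVneq b 0; last exact: H.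
have d0 : d != 0.
  by apply: contra D0 => /eqP ->; rewrite b0 mulr0 mul0r subrr.
have D1 : c * b - d * a != 0 by rewrite -oppr_eq0 opprB (mulrC d) (mulrC c).
rewrite (_ : [set z : T2 | S _] = [set z : T2 |
    [set w : T2 | S (w.2, w.1)] (c * z.1 + d * z.2, a * z.1 + b * z.2)])//.
rewrite H//; last first.
  rewrite (_ : [set w : T2 | _] =
    [set z : T2 | S (0 * z.1 + 1 * z.2, 1 * z.1 + 0 * z.2)]).
    exact: measurable_preimage_lin.
  by apply/seteqP; split => z /=; rewrite !mul1r !mul0r addr0 add0r.
by rewrite area_swap// -normrN opprB (mulrC d) (mulrC c).
Qed.

End area.

Lemma integral_affine {R : realType} (a b p q : R) : p <= q ->
  (\int[lebesgue_measure]_(x in `[p, q]) (a * x + b)%:E =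
   (a * (q ^+ 2 - p ^+ 2) / 2 + b * (q - p))%:E)%E.
Proof.
rewrite le_eqVlt => /predU1P[->|pq].
  by rewrite set_itv1 integral_set1 !subrr !mulr0 mul0r addr0.
pose F (x : R) : R := a / 2 * x ^+ 2 + b * x.
have dF (x : R) : is_derive x (1 : R) F (a * x + b).
  apply: is_derive_eq; rewrite /GRing.scale/=. by field.
have cF : continuous F.
  by move=> y; apply/differentiable_continuous/derivable1_diffP; exact: ex_derive.
rewrite (@continuous_FTC2 _ _ F)//.
- by rewrite -EFinD /F; congr (_%:E); field.
- apply: continuous_subspaceT => x.
  by apply: continuousD; [apply: continuousM => //; exact: cst_continuous | exact: cst_continuous].
- split.
  + by move=> x _; exact: ex_derive.
  + by apply/cvg_at_right_filter; exact: cF.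
  + by apply/cvg_at_left_filter; exact: cF.
- by move=> x _; rewrite derive1E derive_val.
Qed.

(** * Areas of trapezoids and octagons *)

Section area_polygons.
Context {R : realType}.
Local Notation leb := (@lebesgue_measure R).
Local Notation T2 := (measurableTypeR R * measurableTypeR R)%type.

Lemma measurable_lin_ge (a b c : R) : measurable [set z : T2 | c <= a * z.1 + b * z.2].
Proof.
have := measurable_fun_le measurableT (@measurable_lin R 0 0 c) (@measurable_lin R a b 0).
by rewrite setTI; congr measurable; apply/seteqP; split => z /=; rewrite !mul0r !add0r addr0.
Qed.

Lemma measurable_trapezoid (p q m1 b1 m2 b2 : R) :
  measurable [set z : T2 | p <= z.1 <= q /\ m1 * z.1 + b1 <= z.2 <= m2 * z.1 + b2].
Proof.
rewrite (_ : [set z : T2 | _] =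
  ([set z : T2 | p <= 1 * z.1 + 0 * z.2] `&` [set z : T2 | - q <= (-1) * z.1 + 0 * z.2]) `&`
  ([set z : T2 | b1 <= (- m1) * z.1 + 1 * z.2] `&` [set z : T2 | - b2 <= m2 * z.1 + (-1) * z.2])).
  by apply: measurableI; apply: measurableI; exact: measurable_lin_ge.
apply/seteqP; split => -[x y] /=.
  by move=> [/andP[? ?] /andP[? ?]]; split; split; lra.
by move=> [[? ?] [? ?]]; split; apply/andP; split; lra.
Qed.

Lemma area_trapezoid (p q m1 b1 m2 b2 : R) : p <= q ->
  m1 * p + b1 <= m2 * p + b2 -> m1 * q + b1 <= m2 * q + b2 ->
  area [set z : T2 | p <= z.1 <= q /\ m1 * z.1 + b1 <= z.2 <= m2 * z.1 + b2] =
  ((m2 - m1) * (q ^+ 2 - p ^+ 2) / 2 + (b2 - b1) * (q - p))%:E.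
Proof.
move=> pq hp hq.
rewrite -integral_affine// /product_measure1 [RHS]integral_mkcond.
apply: eq_integral => x _ /=.
have [xpq|xpq] := boolP (x \in `[p, q]).
  rewrite patchE mem_set//.
  rewrite (_ : xsection _ _ = `[m1 * x + b1, m2 * x + b2]%classic).
    rewrite lebesgue_measure_itv/= lte_fin.
    move: xpq; rewrite in_itv/= => /andP[px xq].
    (* The gap between the two sides is affine in [x] and nonnegative at both ends. *)
    have h : m1 * x + b1 <= m2 * x + b2 by case: (leP m1 m2) => ?; nra.
    case: ltP => [h'|h']; rewrite -?EFinD; congr (_%:E); first ring.
    lra.
  apply/seteqP; split => y; rewrite /xsection /= inE /= !in_itv/=.
    by case.
  by move=> ->; move: xpq; rewrite in_itv/= => ->.
rewrite patchE memNset//=; last by move=> /= h; rewrite h in xpq.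
rewrite (_ : xsection _ _ = set0) ?measure0//.
apply/seteqP; split => y //; rewrite /xsection /= inE /= => -[h _].
by move: xpq; rewrite in_itv/= h.
Qed.

Lemma rectangleE (p q c d : R) : [set z : T2 | p <= z.1 <= q /\ c <= z.2 <= d] =
  [set z : T2 | p <= z.1 <= q /\ 0 * z.1 + c <= z.2 <= 0 * z.1 + d].
Proof. by apply/seteqP; split => z /=; rewrite !mul0r !add0r. Qed.

Lemma measurable_rectangle (p q c d : R) :
  measurable [set z : T2 | p <= z.1 <= q /\ c <= z.2 <= d].
Proof. by rewrite rectangleE; exact: measurable_trapezoid. Qed.

Lemma area_rectangle (p q c d : R) : p <= q -> c <= d ->
  area [set z : T2 | p <= z.1 <= q /\ c <= z.2 <= d] = ((q - p) * (d - c))%:E.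
Proof.
move=> pq cd; rewrite rectangleE area_trapezoid ?mul0r ?add0r//.
by congr (_%:E); ring.
Qed.

(** Sets of diameter at most [d] for a norm with regular octagonal unit ball lie in such a set: once
    divided by [sqrt 2], the diagonal widths are [d] as well. The offsets are independent, so the
    octagon may be irregular or empty. *)
Definition octagon (A1 A2 A3 A4 d : R) := [set z : T2 |
  [/\ A1 <= z.1 <= A1 + d, A2 <= z.2 <= A2 + d,
      A3 <= z.1 + z.2 <= A3 + Num.sqrt 2 * d &
      A4 <= z.1 - z.2 <= A4 + Num.sqrt 2 * d]].

Lemma measurable_octagon A1 A2 A3 A4 d : measurable (octagon A1 A2 A3 A4 d).
Proof.
rewrite (_ : octagon _ _ _ _ _ =
  ([set z : T2 | A1 <= z.1 <= A1 + d /\ 0 * z.1 + A2 <= z.2 <= 0 * z.1 + (A2 + d)] `&`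
  [set z : T2 | A1 <= z.1 <= A1 + d /\ (-1) * z.1 + A3 <= z.2 <= (-1) * z.1 + (A3 + Num.sqrt 2 * d)]) `&`
  [set z : T2 | A1 <= z.1 <= A1 + d /\ 1 * z.1 - (A4 + Num.sqrt 2 * d) <= z.2 <= 1 * z.1 - A4]).
  by apply: measurableI; [apply: measurableI|]; exact: measurable_trapezoid.
rewrite /octagon; apply/seteqP; split => -[x y] /=.
  move=> [/andP[? ?] /andP[? ?] /andP[? ?] /andP[? ?]].
  by repeat split; apply/andP; split; lra.
move=> [[[/andP[? ?] /andP[? ?]] [_ /andP[? ?]]] [_ /andP[? ?]]].
by split; apply/andP; split; lra.
Qed.

(* Sections at equal distance on both sides of the middle of the projection
   have total length at most that of the regular octagon: Brunn-Minkowski. *)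
Lemma area_octagon A1 A2 A3 A4 d : 0 <= d ->
  (area (octagon A1 A2 A3 A4 d) <= (2 * (Num.sqrt 2 - 1) * d ^+ 2)%:E)%E.
Proof.
move=> d0; set s := Num.sqrt 2.
have s2 : s ^+ 2 = 2 by rewrite sqr_sqrtr.
have s0 : 0 <= s by rewrite sqrtr_ge0.
have s1 : 1 < s by nra.
have s3 : s < 3 / 2 by nra.
set P := octagon _ _ _ _ _.
(* The half sum of the two diagonal constraints is a second constraint on [z.1]. *)
pose L := Num.max A1 ((A3 + A4) / 2).
pose U := Num.min (A1 + d) ((A3 + A4) / 2 + s * d).
have L1 : A1 <= L by rewrite le_max lexx.
have L2 : (A3 + A4) / 2 <= L by rewrite le_max lexx orbT.
have U1 : U <= A1 + d by rewrite ge_min lexx.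
have U2 : U <= (A3 + A4) / 2 + s * d by rewrite ge_min lexx orbT.
have PE z : P z -> [/\ A1 <= z.1 <= A1 + d, A2 <= z.2 <= A2 + d,
    A3 <= z.1 + z.2 <= A3 + s * d & A4 <= z.1 - z.2 <= A4 + s * d] by [].
have PLU z : P z -> L <= z.1 <= U.
  move=> /PE [/andP[? ?] /andP[? ?] /andP[? ?] /andP[? ?]].
  by rewrite ge_max le_min -andbA; apply/and4P; split; lra.
have mP : measurable P by exact: measurable_octagon.
have [UL|LU] := ltP U L.
  have -> : area P = 0%E; last by rewrite lee_fin; nra.
  rewrite (_ : P = set0) ?measure0//.
  by apply/seteqP; split => z // /PLU /andP[a b]; rewrite ltNge (le_trans a b) in UL.
pose c := (L + U) / 2.
(* Half the side of the regular octagon of width [d], whose horizontal sides span the distance [r]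
   on both sides of the centre. *)
pose r := (s - 1) * d / 2.
pose w := (U - L) / 2.
have wd : w <= d / 2 by rewrite /w; lra.
have w0 : 0 <= w by rewrite /w; lra.
pose box := fun p q => [set z : T2 | p <= z.1 <= q /\ A2 <= z.2 <= A2 + d].
have mbox p q : measurable (box p q) by exact: measurable_rectangle.
have box_area p q : p <= q -> area (box p q) = (d * (q - p))%:E.
  by move=> pq; rewrite area_rectangle ?lerDl//; congr (_%:E); ring.
have [wr|rw] := leP w r.
  apply: (@le_trans _ _ (area (box L U))).
    apply: le_measure; rewrite ?inE//.
    by move=> z Pz; split; [exact: PLU|case: (PE _ Pz) => _ /andP[? ?] _ _; apply/andP; split; lra].
  rewrite box_area// lee_fin; rewrite /w /r in wr.
  have : d * (U - L) <= d * ((s - 1) * d) by rewrite ler_wpM2l//; lra.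
  by nra.
(* Farther than [r] from the middle only the diagonal sides are kept. *)
pose right := [set z : T2 | c + r <= z.1 <= U /\
  1 * z.1 - (A4 + s * d) <= z.2 <= (-1) * z.1 + (A3 + s * d)].
pose left := [set z : T2 | L <= z.1 <= c - r /\ (-1) * z.1 + A3 <= z.2 <= 1 * z.1 - A4].
have r0 : 0 <= r by rewrite /r; nra.
have dp : 0 < d by lra.
have mright : measurable right by exact: measurable_trapezoid.
have mleft : measurable left by exact: measurable_trapezoid.
apply: (@le_trans _ _ (area (box (c - r)%R (c + r)%R) + area right + area left)%E).
  apply: le_trans (_ : _ <= area ((box (c - r)%R (c + r)%R `|` right) `|` left))%E _.
    apply: le_measure; rewrite ?inE//; first by apply: measurableU => //; exact: measurableU.
    move=> z Pz; have /andP[Lz zU] := PLU _ Pz.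
    case: (PE _ Pz) => /andP[? ?] /andP[? ?] /andP[? ?] /andP[? ?].
    have [h|h] := leP z.1 (c - r).
      by right; split; apply/andP; split; lra.
    left; have [h'|h'] := leP (c + r) z.1.
      by right; split; apply/andP; split; lra.
    by left; split; apply/andP; split; lra.
  apply: le_trans (measureU2 _ _ _) _ => //; first exact: measurableU.
  by rewrite leeD2r// measureU2.
rewrite box_area ?area_trapezoid//; rewrite /c /w in rw *; [|lra..].
rewrite -!EFinD lee_fin.
(* The sections of [left] and [right] at [c - t] and [c + t] have total length [2 s d - 4 t],
   whatever the offsets; this is integrated from [r] to [w]. *)
suff : (s * d * 2) * (w - r) - 2 * (w ^+ 2 - r ^+ 2) + 2 * d * r <=
    2 * (s - 1) * d ^+ 2.
  by apply: le_trans; rewrite /w /r; nra.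
(* The area of the regular octagon is the same expression at [w = d / 2]. *)
have -> : 2 * (s - 1) * d ^+ 2 = (s * d * 2) * (d / 2 - r) - 2 * ((d / 2) ^+ 2 - r ^+ 2) + 2 * d * r.
  transitivity (2 * (s - 1) * d ^+ 2 - (s ^+ 2 - 2) * d ^+ 2 / 2).
    by rewrite s2 subrr !mul0r subr0.
  by rewrite /r; field.
have sd : d <= s * d by rewrite ler_peMl // ltW.
have : 0 <= (d / 2 - w) * (s * d - d / 2 - w) by apply: mulr_ge0; lra.
by lra.
Qed.

End area_polygons.

(** * Hausdorff measure and area *)

Lemma inf_width {R : realType} (E : set R) (d x : R) :
  (forall y z, E y -> E z -> y - z <= d) -> E x -> inf E <= x <= inf E + d.
Proof.
move=> Ed Ex.
have lb : lbound E (x - d) by move=> y Ey; have := Ed _ _ Ex Ey; lra.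
apply/andP; split; first by apply: ge_inf => //; exists (x - d).
by rewrite -lerBlDr; apply: lb_le_inf => //; exists x.
Qed.

Section ndiam.
Context {R : realType} {X : zmodType} (N : X -> R).

Lemma ndiam_ge0 S : (0 <= ndiam N S)%E.
Proof. by apply: ereal_sup_ubound; left. Qed.

Lemma le_ndiam S x y : S x -> S y -> ((N (x - y))%:E <= ndiam N S)%E.
Proof. by move=> Sx Sy; apply: ereal_sup_ubound; right; exists x, y. Qed.

Lemma ndiam_le S (d : R) : 0 <= d ->
  (forall x y, S x -> S y -> N (x - y) <= d) -> (ndiam N S <= d%:E)%E.
Proof.
move=> d0 H; apply: ge_ereal_sup => _ [->|[x [y [Sx Sy ->]]]]; rewrite lee_fin//.
exact: H.
Qed.

Lemma ndiam0 : ndiam N set0 = 0%E.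
Proof. by apply/eqP; rewrite eq_le ndiam_ge0 andbT; exact: ndiam_le. Qed.

End ndiam.

(** * Isodiametric lower bound for the Hausdorff measure *)

Section lower_bound.
Context {R : realType} {X : zmodType} (N : X -> R).
Local Notation T2 := (measurableTypeR R * measurableTypeR R)%type.
Local Notation sqrt2 := (Num.sqrt 2 : R).

(** In the coordinates [(f, g)] the preimage of a covering set of diameter [e] lies in an octagon of
    width [e], so its area is at most [2 (sqrt 2 - 1) e^2 / |a d - b c|]. Comparison with the cost
    [pi / 4 e^2] of that set gives the constant. *)
Lemma hausdorff2_ge (psi : T2 -> X) (a b c d : R) (E : set T2) :
  let f (z : T2) := a * z.1 + b * z.2 in
  let g (z : T2) := c * z.1 + d * z.2 in
  a * d - b * c != 0 -> measurable E ->
  (forall z w, [/\ f z - f w <= N (psi z - psi w),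
    g z - g w <= N (psi z - psi w),
    (f z + g z) - (f w + g w) <= sqrt2 * N (psi z - psi w) &
    (f z - g z) - (f w - g w) <= sqrt2 * N (psi z - psi w)]) ->
  ((pi * `|a * d - b * c| / (8 * (sqrt2 - 1)))%:E * area E <=
   hausdorff2 N (psi @` E))%E.
Proof.
move=> f g D0 mE H.
set D := `|a * d - b * c|.
have Dp : 0 < D by rewrite normr_gt0.
have s2 : sqrt2 ^+ 2 = 2 by rewrite sqr_sqrtr.
have s0 : 0 <= sqrt2 by rewrite sqrtr_ge0.
have s1 : 1 < sqrt2 by nra.
(* Any one [delta] bounds the supremum from below; a finite one makes all the diameters real. *)
apply: (@le_trans _ _ (hausdorff2_delta N 1 (psi @` E))); last first.
  by apply: ereal_sup_ubound; exists 1 => //=.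
apply: le_ereal_inf_tmp => _ [S [ES Sdiam] <-].
have dE k : ndiam N (S k) = (fine (ndiam N (S k)))%:E.
  rewrite fineK// ge0_fin_numE ?ndiam_ge0//.
  by apply: le_lt_trans (Sdiam k) _; rewrite ltry.
set e := fun k => fine (ndiam N (S k)).
have e0 k : 0 <= e k by rewrite /e fine_ge0// ndiam_ge0.
have eS k z w : S k (psi z) -> S k (psi w) -> N (psi z - psi w) <= e k.
  by move=> Sz Sw; rewrite -lee_fin -dE; exact: le_ndiam.
(* When the preimage is empty the value of [inf] is immaterial, since [P k] only has to contain that
   preimage. *)
pose A (u : T2 -> R) k := inf [set u z | z in psi @^-1` S k].
pose P k := [set z : T2 | octagon (A f k) (A g k) (A (f \+ g) k) (A (f \- g) k)
  (e k) (a * z.1 + b * z.2, c * z.1 + d * z.2)].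
have mP k : measurable (P k).
  by apply: measurable_preimage_lin; exact: measurable_octagon.
have EP : E `<=` \bigcup_k P k.
  move=> z Ez; have [k _ Sk] : (\bigcup_k S k) (psi z) by apply: ES; exists z.
  exists k => //; have s0k : 0 <= sqrt2 * e k by apply: mulr_ge0.
  split; apply: inf_width; try by (exists z).
  - move=> _ _ [x Sx <-] [y Sy <-]; have [+ _ _ _] := H x y.
    by move=> /le_trans; apply; exact: eS.
  - move=> _ _ [x Sx <-] [y Sy <-]; have [_ + _ _] := H x y.
    by move=> /le_trans; apply; exact: eS.
  - move=> _ _ [x Sx <-] [y Sy <-]; have [_ _ + _] := H x y.
    by move=> /le_trans; apply; rewrite ler_wpM2l//; exact: eS.
  - move=> _ _ [x Sx <-] [y Sy <-]; have [_ _ _ +] := H x y.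
    by move=> /le_trans; apply; rewrite ler_wpM2l//; exact: eS.
have K0 : 0 <= pi * D / (8 * (sqrt2 - 1)).
  by apply: divr_ge0; [apply: mulr_ge0; [exact: pi_ge0|exact: ltW]|lra].
apply: (@le_trans _ _ ((pi * D / (8 * (sqrt2 - 1)))%:E *
    \sum_(0 <= k <oo) area (P k))%E).
  by apply: lee_wpmul2l; rewrite ?lee_fin//; exact: measure_sigma_subadditive.
rewrite -nneseriesZl//; apply: lee_nneseries => [k _ _|k _].
  by apply: mule_ge0; rewrite ?lee_fin.
rewrite dE -EFin_expe -EFinM area_lin//; last exact: measurable_octagon.
apply: (@le_trans _ _ ((pi * D / (8 * (sqrt2 - 1)))%:E *
   ((D^-1)%:E * (2 * (sqrt2 - 1) * e k ^+ 2)%:E))%E).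
  apply: lee_wpmul2l; rewrite ?lee_fin//; apply: lee_wpmul2l.
    by rewrite lee_fin invr_ge0 ltW.
  exact: area_octagon.
rewrite -!EFinM lee_fin le_eqVlt; apply/orP; left; apply/eqP.
rewrite -/(e k); field; apply/andP; split; first exact: lt0r_neq0.
by rewrite subr_eq0 gt_eqF.
Qed.

End lower_bound.

(** * Upper bound for the Hausdorff measure by lattice coverings *)

Section upper_bound.
Context {R : realType} {X : lmodType R} (N : X -> R).
Local Notation T2 := (measurableTypeR R * measurableTypeR R)%type.
Hypothesis ND : forall x y, N (x + y) <= N x + N y.
Hypothesis NZ : forall k x, N (k *: x) = `|k| * N x.
Variables (v1 v2 : X) (rho C : R) (g11 g12 g22 : R).
Let phi (z : T2) : X := z.1 *: v1 + z.2 *: v2.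
Let q (z : T2) : R := g11 * z.1 ^+ 2 + 2 * g12 * (z.1 * z.2) + g22 * z.2 ^+ 2.
Hypothesis rho0 : 0 <= rho.
Hypothesis C0 : 0 <= C.
Hypothesis tiles : forall x y : R, exists i j : int,
  N ((x - i%:~R) *: v1 + (y - j%:~R) *: v2) <= rho.
Hypothesis coercive : forall x y : R,
  Num.max `|x| `|y| <= C * N (x *: v1 + y *: v2).
Hypothesis q_ge0 : forall z, 0 <= q z.

Let measurable_le t : measurable [set z | q z <= t].
Proof.
have mq : measurable_fun setT q.
  apply: measurable_funD; last by apply: measurable_funM => //; exact: measurable_funX.
  apply: measurable_funD; apply: measurable_funM => //; first exact: measurable_funX.
  exact: measurable_funM.
have := measurable_fun_le measurableT mq (measurable_cst t).
by rewrite setTI.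
Qed.

Let area_le (t : R) : 0 < t ->
  area [set z | q z <= t] = (t%:E * area [set z | (q z <= 1)%R])%E.
Proof.
move=> t0; pose k := (Num.sqrt t)^-1.
have k2 : k * k = t^-1 by rewrite -invfM -expr2 sqr_sqrtr// ltW.
have D : k * k - 0 * 0 = t^-1 by rewrite mul0r subr0.
have D0 : k * k - 0 * 0 != 0 by rewrite D invr_eq0 gt_eqF.
have := area_lin D0 (measurable_le 1).
rewrite D gtr0_norm ?invr_gt0// invrK => <-; congr (area _).
apply/seteqP; split => z /=; rewrite !mul0r addr0 add0r /q /=.
  move=> h; rewrite -(ler_pM2l t0) mulr1; apply: le_trans h.
  rewrite le_eqVlt; apply/orP; left; apply/eqP.
  transitivity (t * (k * k) * (g11 * z.1 ^+ 2 + 2 * g12 * (z.1 * z.2) + g22 * z.2 ^+ 2)); first ring.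
  by rewrite k2 divff ?gt_eqF// mul1r.
move=> h; rewrite -(ler_pM2l t0) mulr1 in h; apply: le_trans h.
rewrite le_eqVlt; apply/orP; left; apply/eqP.
transitivity (t * (k * k) * (g11 * z.1 ^+ 2 + 2 * g12 * (z.1 * z.2) + g22 * z.2 ^+ 2)); last ring.
by rewrite k2 divff ?gt_eqF// mul1r.
Qed.

Let G := `|g11| + 2 * `|g12| + `|g22|.

Let q_le_max (z : T2) (m : R) : `|z.1| <= m -> `|z.2| <= m -> q z <= G * m ^+ 2.
Proof.
move=> h1 h2; have m0 : 0 <= m by apply: le_trans h1.
have H (r x y : R) : `|x| <= m -> `|y| <= m -> r * (x * y) <= `|r| * m ^+ 2.
  move=> hx hy; apply: le_trans (ler_norm _) _; rewrite !normrM expr2.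
  by rewrite ler_wpM2l// ler_pM.
have h11 := H g11 _ _ h1 h1; have h12 := H g12 _ _ h1 h2; have h22 := H g22 _ _ h2 h2.
by rewrite /q /G; lra.
Qed.

(** The right side minus the left is [eta^-1 q (eta z - w)]. *)
Let qD (z w : T2) (eta : R) : 0 < eta ->
  q (z.1 + w.1, z.2 + w.2) <= (1 + eta) * q z + (1 + eta^-1) * q w.
Proof.
move=> eta0; have := q_ge0 (eta * z.1 - w.1, eta * z.2 - w.2).
rewrite -(ler_pM2l (_ : 0 < eta^-1)) ?invr_gt0// mulr0 -subr_ge0 subr0 => h.
rewrite -subr_ge0; apply: le_trans h _; rewrite le_eqVlt; apply/orP; left.
by apply/eqP; rewrite /q /=; field; rewrite gt_eqF.
Qed.

(** A ball of radius [rho h] costs at most [pi / 4 (2 rho h)^2], which is [pi rho^2] times the area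
    of a cell of the lattice of mesh [h]. For small [h] the cells used stay in the ellipse
    [q <= 1 + 2 eta]. *)
Lemma hausdorff2_le (E : set X) (eta : R) : 0 < eta ->
  E `<=` [set phi z | z in [set z | q z <= 1]] ->
  (hausdorff2 N E <=
   (pi * rho ^+ 2 * (1 + 2 * eta))%:E * area [set z | (q z <= 1)%R])%E.
Proof.
move=> eta0 Eq; apply: ge_ereal_sup => _ [delta d0 <-].
have K0 : 0 <= C * rho + 1 by apply: addr_ge0 => //; exact: mulr_ge0.
have G0 : 0 <= G by rewrite !addr_ge0// mulr_ge0.
(* A point of a cell differs from a point of its tile by at most [(C rho + 1) h] in each coordinate:
   [C rho h] up to the lattice point, by coercivity, and [h] inside the cell. So [M h^2] bounds the
   error term of [qD]. *)
pose M := (1 + eta^-1) * (G * (C * rho + 1) ^+ 2).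
have M0 : 0 <= M.
  by rewrite /M !mulr_ge0// ?exprn_ge0// addr_ge0// invr_ge0 ltW.
have [h [h0 hd hM]] : exists h : R, [/\ 0 < h, 2 * (rho * h) <= delta & M * h ^+ 2 <= eta].
  exists (Num.min (delta / (2 * rho + 1)) (Num.min 1 (eta / (M + 1)))).
  have p1 : 0 < 2 * rho + 1 by rewrite ltr_wpDl// mulr_ge0.
  have p2 : 0 < M + 1 by rewrite ltr_wpDl.
  set h := Num.min _ _.
  have hd : h <= delta / (2 * rho + 1) by rewrite ge_min lexx.
  have h1 : h <= 1 by rewrite !ge_min lexx orbT.
  have he : h <= eta / (M + 1) by rewrite !ge_min lexx !orbT.
  have h0 : 0 < h by rewrite !lt_min ltr01 !divr_gt0.
  rewrite ler_pdivlMr// in hd; rewrite ler_pdivlMr// in he.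
  split => //; first by lra.
  have : M * h ^+ 2 <= M * h by rewrite ler_wpM2l// expr2 ler_piMl// ltW.
  by lra.
(* The tiles around the points of a fine lattice cover the disc; the half-open
   cells of the same lattice, being disjoint, are used to count them. *)
pose lam k : T2 := if @pickle_inv (int * int)%type k is Some ij
  then (h * ij.1%:~R, h * ij.2%:~R) else (0, 0).
pose tile k := [set z : T2 | N (phi (z.1 - (lam k).1, z.2 - (lam k).2)) <= rho * h].
(* Asking for a code excludes the indices at which [lam] takes its default value, whose cells would
   not be disjoint from the others. *)
pose ok k := (exists ij : int * int, pickle_inv k = Some ij) /\ exists2 z, tile k z & q z <= 1.
pose Q k := if `[< ok k >] then
  `[(lam k).1, (lam k).1 + h[ `*` `[(lam k).2, (lam k).2 + h[ else set0.
pose S k := if `[< ok k >] then phi @` tile k else set0.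
have phiB z w : phi z - phi w = phi (z.1 - w.1, z.2 - w.2).
  by rewrite /phi /= !scalerBl opprD addrACA.
have NB x y : N (x - y) <= N x + N y.
  by apply: le_trans (ND _ _) _; rewrite -scaleN1r NZ normrN1 mul1r.
have Sdiam k : (ndiam N (S k) <= (2 * (rho * h))%:E)%E.
  have rh : 0 <= 2 * (rho * h) by rewrite !mulr_ge0// ltW.
  apply: ndiam_le => //; rewrite /S; case: asboolP => // _ _ _ [z tz <-] [w tw <-].
  have -> : phi z - phi w = phi (z.1 - (lam k).1, z.2 - (lam k).2) -
      phi (w.1 - (lam k).1, w.2 - (lam k).2).
    by rewrite !phiB /=; congr phi; congr pair; ring.
  by apply: le_trans (NB _ _) _; rewrite /tile /= in tz tw; lra.
have cover : E `<=` \bigcup_k S k.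
  move=> x /Eq [z qz <-].
  have [i [j ij]] := tiles (z.1 / h) (z.2 / h).
  exists (pickle (i, j)) => //.
  have tz : tile (pickle (i, j)) z.
    rewrite /tile /lam pickleK_inv /= /phi /=.
    rewrite (_ : z.1 - _ = h * (z.1 / h - i%:~R)); last by field; rewrite gt_eqF.
    rewrite (_ : z.2 - _ = h * (z.2 / h - j%:~R)); last by field; rewrite gt_eqF.
    by rewrite -!scalerA -scalerDr NZ gtr0_norm// mulrC ler_pM2r.
  rewrite /S ifT; first by exists z.
  by apply/asboolP; split; [exists (i, j); rewrite pickleK_inv|exists z].
have mQ k : measurable (Q k).
  by rewrite /Q; case: asboolP => // _; exact: measurableX.
have areaQ k : ok k -> area (Q k) = (h ^+ 2)%:E.
  move=> okk; rewrite /Q ifT; last by apply/asboolP.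
  have itvE (u : R) : lebesgue_measure (`[u, u + h[%classic : set R) = h%:E.
    by rewrite lebesgue_measure_itv/= lte_fin ltrDl h0 -EFinD addrC addKr.
  transitivity (lebesgue_measure (`[(lam k).1, ((lam k).1 + h)%R[%classic : set R) *
      lebesgue_measure (`[(lam k).2, ((lam k).2 + h)%R[%classic : set R))%E.
    exact: product_measure1E.
  by rewrite !itvE -EFinM -expr2.
(* Used in both directions: a number lies in only one half-open cell. *)
have ler_cell (u : R) (i j : int) :
    h * i%:~R <= u < h * i%:~R + h -> h * j%:~R <= u < h * j%:~R + h -> i <= j.
  move=> /andP[iu _] /andP[_ uj]; have := le_lt_trans iu uj.
  rewrite -[X in _ + X]mulr1 -mulrDr ltr_pM2l// -(intrD _ _ 1) ltr_int.
  by rewrite ltzD1.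
have tQ : trivIset setT Q.
  apply/trivIsetP => k l _ _ kl; apply/seteqP; split => // -[w1 w2] [].
  rewrite /Q; case: asboolP => // -[[[i j] kij] _]; case: asboolP => // -[[[i' j'] lij] _].
  rewrite /lam kij lij /= !in_itv/= => -[w1i w2j] [w1i' w2j'].
  move/eqP: kl; apply.
  have <- : pickle (i, j) = k by have := @pickle_invK (int * int)%type k; rewrite kij.
  have <- : pickle (i', j') = l by have := @pickle_invK (int * int)%type l; rewrite lij.
  by congr (pickle (_, _)); apply/eqP; rewrite eq_le; apply/andP;
    split; apply: ler_cell; eassumption.
have Qsub : \bigcup_k Q k `<=` [set z | q z <= 1 + 2 * eta].
  move=> -[w1 w2] [k _]; rewrite /Q; case: asboolP => // -[_ [z tz qz]] [] /=.
  rewrite !in_itv/= => /andP[a1 a2] /andP[b1 b2].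
  have := coercive (z.1 - (lam k).1) (z.2 - (lam k).2).
  rewrite ge_max => /andP[c1 c2].
  have cz : C * N (phi (z.1 - (lam k).1, z.2 - (lam k).2)) <= C * (rho * h).
    by apply: ler_wpM2l.
  have {c1}:= le_trans c1 cz; have {c2} := le_trans c2 cz.
  rewrite !ler_norml => /andP[c1 c2] /andP[c3 c4].
  have e1 : `|w1 - z.1| <= (C * rho + 1) * h by rewrite ler_norml; apply/andP; split; lra.
  have e2 : `|w2 - z.2| <= (C * rho + 1) * h by rewrite ler_norml; apply/andP; split; lra.
  (* By [qD], the value of [q] at [(w1, w2)] is at most [1 + eta + M h^2]. *)
  have := q_le_max (z := (w1 - z.1, w2 - z.2)) e1 e2.
  have := qD z (w1 - z.1, w2 - z.2) eta0.
  rewrite /= !subrKC => hq hm.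
  have i0 : 0 <= 1 + eta^-1 by rewrite addr_ge0// invr_ge0 ltW.
  have := ler_wpM2l i0 hm.
  have : (1 + eta) * q z <= 1 + eta by rewrite -[leRHS]mulr1 ler_wpM2l//; lra.
  by rewrite /M in hM; lra.
apply: (@le_trans _ _ (\sum_(0 <= k <oo) (pi / 4)%:E * ndiam N (S k) ^+ 2)%E).
  apply: ereal_inf_lbound; exists S => //; split => // k.
  by apply: le_trans (Sdiam k) _; rewrite lee_fin.
apply: (@le_trans _ _ (\sum_(0 <= k <oo) (pi * rho ^+ 2)%:E * area (Q k))%E).
  apply: lee_nneseries => [k _ _|k _].
    by apply: mule_ge0; rewrite ?lee_fin ?divr_ge0 ?pi_ge0// expe_ge0// ndiam_ge0.
  have [okk|nok] := pselect (ok k); last first.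
    have -> : S k = set0 by rewrite /S; case: asboolP.
    have -> : Q k = set0 by rewrite /Q; case: asboolP.
    by rewrite ndiam0 measure0 mule0 expe2 mule0 mule0.
  rewrite areaQ//; apply: (@le_trans _ _ ((pi / 4)%:E * ((2 * (rho * h))%:E ^+ 2))%E).
    rewrite lee_wpmul2l ?lee_fin ?divr_ge0 ?pi_ge0//.
    by rewrite !expe2; apply: lee_pmul => //; exact: ndiam_ge0.
  by rewrite -EFin_expe -!EFinM lee_fin; rewrite le_eqVlt; apply/orP; left; apply/eqP; field.
rewrite nneseriesZl//.
rewrite [(pi * _ * _)%:E]EFinM -muleA; apply: lee_wpmul2l.
  by rewrite lee_fin mulr_ge0 ?pi_ge0// exprn_ge0.
rewrite -area_le; last by lra.
rewrite -measure_semi_bigcup//; last by apply: bigcup_measurable => k _; exact: mQ.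
apply: le_measure; rewrite ?inE//; by apply: bigcup_measurable => k _; exact: mQ.
Qed.

(** Positivity here and finiteness in [area_le1_fin] allow the area of the ellipse to be cancelled
    between the two bounds. *)
Lemma area_le1_gt0 : (0 < area [set z | (q z <= 1)%R])%E.
Proof.
have G0 : 0 <= G by rewrite !addr_ge0// mulr_ge0.
pose m := (G + 1)^-1.
have G1 : 0 < G + 1 by rewrite ltr_wpDl.
have m0 : 0 < m by rewrite invr_gt0.
have mG : m * (G + 1) = 1 by rewrite mulVf// gt_eqF.
have m1 : m <= 1 by rewrite invf_le1// lerDr.
apply: (@lt_le_trans _ _ (area [set z : T2 | 0 <= z.1 <= m /\ 0 <= z.2 <= m])).
  by rewrite area_rectangle ?ltW// lte_fin !subr0 mulr_gt0.
apply: le_measure; rewrite ?inE//; first exact: measurable_rectangle.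
move=> z [/andP[z1 z2] /andP[z3 z4]] /=.
have := @q_le_max z m; rewrite !ger0_norm// => /(_ z2 z4) h; apply: le_trans h _.
have -> : G * m ^+ 2 = m * (m * (G + 1)) - m * m by ring.
by rewrite mG mulr1; nra.
Qed.

Lemma area_le1_fin (K : R) : 0 <= K ->
  (forall z, q z <= 1 -> `|z.1| <= K /\ `|z.2| <= K) ->
  area [set z | (q z <= 1)%R] \is a fin_num.
Proof.
move=> K0 qK; rewrite ge0_fin_numE//.
apply: (@le_lt_trans _ _ (area [set z : T2 | - K <= z.1 <= K /\ - K <= z.2 <= K])).
  apply: le_measure; rewrite ?inE//; first exact: measurable_rectangle.
  by move=> z /= /qK; rewrite !ler_norml.
by rewrite area_rectangle ?ltry// ge0_cp.
Qed.

(** The lower bound for the image and the upper bound for [E] are multiples of the area of the same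
    ellipse. Cancelling this area and letting [eta] tend to 0 leaves the determinant. *)
Lemma contraction_det_le (psi : T2 -> X) (a b c d K : R) (E : set X) :
  let f (z : T2) := a * z.1 + b * z.2 in
  let g (z : T2) := c * z.1 + d * z.2 in
  0 <= K ->
  (forall z, q z <= 1 -> `|z.1| <= K /\ `|z.2| <= K) ->
  (forall z w, [/\ f z - f w <= N (psi z - psi w),
    g z - g w <= N (psi z - psi w),
    (f z + g z) - (f w + g w) <= Num.sqrt 2 * N (psi z - psi w) &
    (f z - g z) - (f w - g w) <= Num.sqrt 2 * N (psi z - psi w)]) ->
  E `<=` [set phi z | z in [set z | q z <= 1]] ->
  (hausdorff2 N (psi @` [set z | (q z <= 1)%R]) <= hausdorff2 N E)%E ->
  `|a * d - b * c| <= 8 * (Num.sqrt 2 - 1) * rho ^+ 2.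
Proof.
move=> f g K0 qK H Eq HE.
have s2 : (Num.sqrt 2 : R) ^+ 2 = 2 by rewrite sqr_sqrtr.
have s0 : 0 <= (Num.sqrt 2 : R) by rewrite sqrtr_ge0.
have s1 : 0 < Num.sqrt 2 - 1 :> R by nra.
have [->|D0] := eqVneq (a * d - b * c) 0.
  by rewrite normr0 mulr_ge0 ?exprn_ge0// mulr_ge0// ltW.
have low := hausdorff2_ge D0 (measurable_le 1) H.
have afin := area_le1_fin K0 qK; have agt0 := area_le1_gt0.
set al := area _ in low afin agt0.
have a0 : 0 < fine al by rewrite fine_gt0// agt0 ltey_eq afin.
have key eta : 0 < eta -> `|a * d - b * c| <= 8 * (Num.sqrt 2 - 1) * rho ^+ 2 * (1 + 2 * eta).
  move=> eta0; have := le_trans low (le_trans HE (hausdorff2_le eta0 Eq)).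
  rewrite -/al -(fineK afin) -!EFinM lee_fin ler_pM2r//.
  have -> : pi * rho ^+ 2 * (1 + 2 * eta) = pi * (rho ^+ 2 * (1 + 2 * eta)) by ring.
  rewrite -mulrA ler_pM2l ?pi_gt0// ler_pdivrMr; last by rewrite mulr_gt0.
  by move=> h; apply: le_trans h _; rewrite le_eqVlt; apply/orP; left; apply/eqP; ring.
apply/ler_addgt0Pr => eps eps0.
have M0 : 0 <= 8 * (Num.sqrt 2 - 1) * rho ^+ 2 by rewrite mulr_ge0 ?exprn_ge0// mulr_ge0// ltW.
set M := _ * rho ^+ 2 in M0 key *; clearbody M.
have p1 : 0 < 2 * M + 1 by rewrite ltr_wpDl// mulr_ge0.
(* With this [eta] the excess [2 M eta] is at most [eps]. *)
have e0 : 0 < eps / (2 * M + 1) by rewrite divr_gt0.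
apply: le_trans (key _ e0) _; rewrite mulrDr mulr1 lerD2l.
by rewrite !mulrA ler_pdivrMr//; lra.
Qed.

End upper_bound.

(** * Contractions restricted to one plane *)

Section plane.
Context {R : realType} {X : vectType R} (N : X -> R) (ip : {dot X for idfun}).
Local Notation T2 := (measurableTypeR R * measurableTypeR R)%type.
Hypothesis ND : forall x y, N (x + y) <= N x + N y.
Hypothesis NZ : forall k x, N (k *: x) = `|k| * N x.
Hypothesis N_ip : forall x, N x ^+ 2 <= 4 * ip x x.
Variables (p : 'End(X)) (v1 v2 : X) (C : R).
Hypothesis C0 : 0 <= C.
Hypothesis tiles : forall x y : R, exists i j : int,
  N ((x - i%:~R) *: v1 + (y - j%:~R) *: v2) <= 1.
Hypothesis coercive : forall x y : R,
  Num.max `|x| `|y| <= C * N (x *: v1 + y *: v2).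
Hypothesis contraction : forall V : {vspace X}, \dim V = 2%N ->
  forall A : set X, euclidean_disc ip V A ->
    (hausdorff2 N (p @` A) <= hausdorff2 N A)%E.
Variables h1 h2 : X -> R.
Hypothesis h1D : forall x y, h1 (x + y) = h1 x + h1 y.
Hypothesis h1Z : forall k x, h1 (k *: x) = k * h1 x.
Hypothesis h2D : forall x y, h2 (x + y) = h2 x + h2 y.
Hypothesis h2Z : forall k x, h2 (k *: x) = k * h2 x.
Hypothesis h_le : forall x, [/\ h1 (p x) <= N (p x), h2 (p x) <= N (p x),
  h1 (p x) + h2 (p x) <= Num.sqrt 2 * N (p x) &
  h1 (p x) - h2 (p x) <= Num.sqrt 2 * N (p x)].

(** The contraction is tested on the Euclidean unit disc of the plane; in the basis [v1], [v2] this
    is the ellipse of their Gram matrix. *)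
Lemma plane_det_le :
  `|h1 (p v1) * h2 (p v2) - h1 (p v2) * h2 (p v1)| <= 8 * (Num.sqrt 2 - 1).
Proof.
pose phi (z : T2) := z.1 *: v1 + z.2 *: v2.
have qE (z : T2) : ip (phi z) (phi z) =
    ip v1 v1 * z.1 ^+ 2 + 2 * ip v1 v2 * (z.1 * z.2) + ip v2 v2 * z.2 ^+ 2.
  have ipC x y : ip x y = ip y x by rewrite hermC expr0 mul1r.
  rewrite /phi !(linearDl, linearDr, linearZl_LR, linearZr_LR) /=.
  by rewrite (ipC v2 v1) /GRing.scale /=; ring.
have ip0 x : 0 <= ip x x.
  have [->|x0] := eqVneq x 0; first by rewrite linear0l.
  by rewrite ltW// neq0_dnorm_gt0.
have N00 : N 0 = 0 by rewrite -(scale0r 0) NZ normr0 mul0r.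
have N0 x : 0 <= N x.
  by have := ND x ((- 1) *: x); rewrite NZ normrN1 mul1r scaleN1r subrr N00; lra.
have qK (z : T2) : ip v1 v1 * z.1 ^+ 2 + 2 * ip v1 v2 * (z.1 * z.2) + ip v2 v2 * z.2 ^+ 2 <= 1 ->
    `|z.1| <= C * 2 /\ `|z.2| <= C * 2.
  rewrite -qE => q1; have := coercive z.1 z.2; rewrite -/(phi z) ge_max => /andP[a1 a2].
  (* The comparison with the Euclidean norm makes the ellipse bounded in coordinates. *)
  have N2 : N (phi z) <= 2.
    have := N_ip (phi z) => h.
    rewrite -(ler_pXn2r (_ : 0 < 2)%N) ?nnegrE//; lra.
  by split; [apply: le_trans a1 _|apply: le_trans a2 _]; rewrite ler_wpM2l.
(* Coercivity forces [v1] and [v2] to be independent. *)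
have dim2 : \dim <<[:: v1; v2]>> = 2%N.
  apply/eqP/(@freeP _ _ 2 [tuple v1; v2]) => k.
  rewrite !big_ord_recl big_ord0 /= addr0 => k0.
  have := coercive (k ord0) (k (lift ord0 ord0)).
  rewrite /= k0 N00 mulr0 ge_max !normr_le0 => /andP[/eqP e1 /eqP e2].
  by move=> [[|[|//]] i]; [rewrite -[RHS]e1|rewrite -[RHS]e2]; congr (k _);
    exact: val_inj.
pose A := [set x | x \in <<[:: v1; v2]>>%VS /\ ip (x - 0) (x - 0) <= 1 ^+ 2].
have disc : euclidean_disc ip <<[:: v1; v2]>>%VS A.
  by exists 0, 1; split => //; exact: mem0v.
have phiV z : phi z \in <<[:: v1; v2]>>%VS.
  by rewrite memvD// memvZ// memv_span// !inE eqxx ?orbT.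
have AE : A = phi @` [set z : T2 |
    ip v1 v1 * z.1 ^+ 2 + 2 * ip v1 v2 * (z.1 * z.2) + ip v2 v2 * z.2 ^+ 2 <= 1].
  apply/seteqP; split => x.
    move=> [xV]; rewrite subr0 expr1n => x1.
    move: xV; rewrite span_cons span_seq1 => /memv_addP[_ /vlineP[k1 ->] [_ /vlineP[k2 ->] xE]].
    by exists (k1, k2); [rewrite /= -(qE (k1, k2)) /phi /= -xE | rewrite /phi /= -xE].
  move=> [z /=]; rewrite -qE => z1 <-; split => //; by rewrite subr0 expr1n.
have HA := contraction dim2 disc.
have := @contraction_det_le R X N ND NZ v1 v2 1 C (ip v1 v1) (ip v1 v2) (ip v2 v2)
  ler01 C0 tiles coercive _ (p \o phi) (h1 (p v1)) (h1 (p v2)) (h2 (p v1)) (h2 (p v2))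
  (C * 2) A.
rewrite expr1n mulr1; apply => //.
- by move=> z; rewrite -qE.
- by rewrite mulr_ge0.
- move=> z w /=.
  have -> : p (phi z) - p (phi w) = p (phi (z.1 - w.1, z.2 - w.2)).
    by rewrite -linearB /phi /= !scalerBl opprD addrACA.
  have [] := h_le (phi (z.1 - w.1, z.2 - w.2)).
  have -> u : h1 (p (phi u)) = u.1 * h1 (p v1) + u.2 * h1 (p v2).
    by rewrite /phi linearD !linearZ /= h1D !h1Z.
  have -> u : h2 (p (phi u)) = u.1 * h2 (p v1) + u.2 * h2 (p v2).
    by rewrite /phi linearD !linearZ /= h2D !h2Z.
  move=> /= b1 b2 b3 b4.
  by split; lra.
- by rewrite AE.
- by rewrite -image_comp -AE.
Qed.
End plane.

(** * Tilings *)

Lemma floor_frac {R : realType} (x : R) : exists i : int, 0 <= x - i%:~R < 1.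
Proof.
exists (Num.floor x); have /andP[h1 h2] := floor_itv x.
by rewrite intrD in h2; apply/andP; split; lra.
Qed.

(** The larger of [|u + v|] and [|u - v|] equals [|u| + |v|]. *)
Lemma addr_norm_le {R : realType} (u v M : R) :
  `|u + v| <= M -> `|u - v| <= M -> `|u| + `|v| <= M.
Proof.
rewrite !ler_norml => /andP[? ?] /andP[? ?].
by case: (ger0P u) => ?; case: (ger0P v) => ?; lra.
Qed.

(** The left side is twice the maximum norm, so its unit ball is the unit square centred at 0;
    rounding to nearest integers lands in it. *)
Lemma square_tiling {R : realType} (x y : R) : exists i j : int,
  `|x - i%:~R + (y - j%:~R)| + `|x - i%:~R - (y - j%:~R)| <= 1.
Proof.
have [i /andP[i0 i1]] := floor_frac (x + 1 / 2).
have [j /andP[j0 j1]] := floor_frac (y + 1 / 2).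
by exists i, j; apply: addr_norm_le; rewrite ler_norml; apply/andP; split; lra.
Qed.

(* The norm x v1 + y v2 takes in each of the four planes with a hexagonal unit
   ball, when v1 and v2 generate the lattice of translations of the tiling of
   the plane by that hexagon. *)
Definition hexnorm {R : realType} (x y : R) : R :=
  `|(5 / 2 - Num.sqrt 2) * x + y / 2| + `|(Num.sqrt 2 - 1) * (x - y)| +
  `|x / 2 + (5 / 2 - Num.sqrt 2) * y|.

Section sqrt2.
Context {R : realType}.
Local Notation s := (Num.sqrt 2 : R).

Lemma sqr_sqrt2 : s ^+ 2 = 2.
Proof. by rewrite sqr_sqrtr. Qed.

Lemma sqrt2_bounds : 7 / 5 < s < 99 / 70.
Proof.
have s2 := sqr_sqrt2; have s0 : 0 <= s by rewrite sqrtr_ge0.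
by apply/andP; split; nra.
Qed.

Lemma invr_sqrt2 : s^-1 = s / 2.
Proof.
have s2 := sqr_sqrt2; have /andP[s1 _] := sqrt2_bounds.
by field: s2; rewrite gt_eqF//; lra.
Qed.

(** The two outer terms of [hexnorm] add up to the larger of [(3 - s) |x + y|] and
    [(2 - s) |x - y|]; with the middle term these give the second and the first hypothesis. *)
Lemma hexnorm_le1 (x y : R) : `|x - y| <= 1 ->
  (3 - s) * `|x + y| <= 1 - (s - 1) * `|x - y| -> hexnorm x y <= 1.
Proof.
have /andP[s1 s2] := sqrt2_bounds.
move=> h1 h2; rewrite /hexnorm addrAC -lerBrDr normrM (gtr0_norm (_ : 0 < s - 1)); last lra.
apply: addr_norm_le.
  rewrite (_ : _ + _ = (3 - s) * (x + y)); last by field.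
  by rewrite normrM gtr0_norm//; lra.
rewrite (_ : _ - _ = (2 - s) * (x - y)); last by field.
by rewrite normrM gtr0_norm; lra.
Qed.

Lemma hexnormC (x y : R) : hexnorm x y = hexnorm y x.
Proof.
rewrite /hexnorm (_ : (s - 1) * (y - x) = - ((s - 1) * (x - y))); last by ring.
rewrite normrN (addrC (_ * y)) (addrC (y / 2)); ring.
Qed.

(** Integer translations and the exchange of coordinates reduce to the triangle [0 <= y <= x <= 1].
    The hexagons centred at its vertices cover it: for [x + y <= 1] the conditions for [(0, 0)] and
    [(1, 0)] are complementary, beyond that those for [(1, 1)] and [(1, 0)]. *)
Lemma hexagon_tiling (x y : R) : exists i j : int,
  hexnorm (x - i%:~R) (y - j%:~R) <= 1.
Proof.
have /andP[s1 s2] := sqrt2_bounds.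
wlog : x y / (forall x y : R, 0 <= y -> y <= x -> x <= 1 ->
    exists i j : int, hexnorm (x - i%:~R) (y - j%:~R) <= 1).
  apply; move=> {}x {}y y0 yx x1.
  have pxy : `|x - y| = x - y by rewrite ger0_norm//; lra.
  have pxy1 : `|x - 1 - y| = 1 - (x - y) by rewrite ler0_norm; lra.
  have [p1|p1] := leP (x + y) 1.
    have [h|h] := leP ((3 - s) * (x + y) + (s - 1) * (x - y)) 1.
      exists 0, 0; rewrite !subr0; apply: hexnorm_le1; rewrite pxy ?ger0_norm; lra.
    exists 1, 0; rewrite subr0; apply: hexnorm_le1; rewrite pxy1; first lra.
    by rewrite ler0_norm; lra.
  have [h|h] := leP ((3 - s) * (2 - (x + y)) + (s - 1) * (x - y)) 1.
    exists 1, 1; apply: hexnorm_le1; rewrite (_ : x - 1 - (y - 1) = x - y) ?pxy; try lra; try ring.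
    by rewrite ler0_norm; lra.
  exists 1, 0; rewrite subr0; apply: hexnorm_le1; rewrite pxy1; first lra.
  by rewrite ger0_norm; lra.
move=> H; have [i /andP[i0 i1]] := floor_frac x; have [j /andP[j0 j1]] := floor_frac y.
have [h|h] := leP (y - j%:~R) (x - i%:~R).
  have [i' [j' h']] := H _ _ j0 h (ltW i1).
  by exists (i + i'), (j + j'); rewrite !intrD !opprD !addrA.
have [j' [i' h']] := H _ _ i0 (ltW h) (ltW j1).
by exists (i + i'), (j + j'); rewrite !intrD !opprD !addrA hexnormC.
Qed.

(** The reverse triangle inequality on the outer terms gives [hexnorm x y >= (2 - s) (|x| + |y|)],
    and [2 (2 - s) >= 1]. *)
Lemma hexnorm_coercive (x y : R) : Num.max `|x| `|y| <= 2 * hexnorm x y.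
Proof.
have /andP[s1 s2] := sqrt2_bounds.
have h (u v : R) : (5 / 2 - s) * `|u| <= `|(5 / 2 - s) * u + v / 2| + `|v| / 2.
  have -> : (5 / 2 - s) * `|u| = `|(5 / 2 - s) * u + v / 2 - v / 2|.
    by rewrite addrK normrM (gtr0_norm (_ : 0 < 5 / 2 - s))//; lra.
  have -> : `|v| / 2 = `|v / 2| by rewrite normrM [`|2^-1|]ger0_norm.
  exact: ler_normB.
have hx := h x y; have := h y x; rewrite [_ * y + _]addrC => hy.
have n0 := normr_ge0 ((s - 1) * (x - y)).
have x0 : 0 <= (3 - 2 * s) * `|x| by apply: mulr_ge0 => //; lra.
have y0 : 0 <= (3 - 2 * s) * `|y| by apply: mulr_ge0 => //; lra.
have x1 := normr_ge0 x; have y1 := normr_ge0 y.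
rewrite /hexnorm ge_max; apply/andP; split; lra.
Qed.

Lemma sqrt2_contradiction (a b c d : R) :
  `|1 + a - d - (a * d - b * c)| <= 12 * s - 16 ->
  `|1 - a + d - (a * d - b * c)| <= 12 * s - 16 ->
  `|(4 - 5 * s / 2) * (2 + (a - d) + (c - b))| <= 12 * s - 16 ->
  `|(4 - 5 * s / 2) * (2 + (a - d) - (c - b))| <= 12 * s - 16 ->
  `|(4 - 5 * s / 2) * (2 - (a - d) + (a + d))| <= 12 * s - 16 ->
  `|(4 - 5 * s / 2) * (2 - (a - d) - (a + d))| <= 12 * s - 16 ->
  False.
Proof.
have /andP[s1 s2] := sqrt2_bounds.
rewrite !ler_norml => /andP[_ k1] /andP[_ k2].
(* The quotient of [12 s - 16] by [4 - 5 s / 2] is about 2.09. *)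
have lin (X : R) : - (12 * s - 16) <= (4 - 5 * s / 2) * X <= 12 * s - 16 -> X <= 21 / 10.
  by move=> /andP[_ h]; rewrite leNgt; apply/negP => h'; nra.
move=> /lin h1 /lin h2 /lin h3 /lin h4.
(* The first two bounds add up to [a d - b c >= 17 - 12 s], and [17 - 12 (99 / 70) = 1 / 35]. *)
have m : 1 / 35 <= a * d - b * c by lra.
(* The difference is [(a - d)^2 + (b + c)^2]. *)
have : 4 * (a * d - b * c) <= (a + d) ^+ 2 + (c - b) ^+ 2 by nra.
have : (a + d) ^+ 2 + (c - b) ^+ 2 <= (2 / 10) ^+ 2.
  (* In the sum of one bound from [h1], [h2] and one from [h3], [h4] the terms in [a - d] cancel. *)
  have : `|a + d| + `|c - b| <= 2 / 10.
    by case: (ger0P (a + d)) => ?; case: (ger0P (c - b)) => ?; lra.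
  rewrite -(real_normK (num_real (a + d))) -(real_normK (num_real (c - b))).
  by have := normr_ge0 (a + d); have := normr_ge0 (c - b); nra.
by lra.
Qed.

End sqrt2.

(** * The crosspolytope *)

Lemma big_ord4 (V : zmodType) (F : 'I_4 -> V) :
  \sum_i F i = F (inord 0) + F (inord 1) + F (inord 2) + F (inord 3).
Proof.
rewrite !big_ord_recl big_ord0 addr0 !addrA.
by congr (F _ + F _ + F _ + F _); apply/val_inj; rewrite /= inordK.
Qed.

Section crosspolytope.
Context {R : realType} {X : vectType R} (ip : {dot X for idfun}) (e : 4.-tuple X).
Hypothesis e_basis : basis_of fullv e.
Hypothesis e_orthonormal : orthonormal ip e.
Local Notation s := (Num.sqrt 2 : R).
Local Notation c k x := (coord e (inord k) x).

Definition cross_norm (y0 y1 y2 y3 : R) : R :=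
  `|(y0 + y2) / s| + `|(y1 - y3) / s| + `|(y0 - y1 - y2 - y3) / 2| +
  `|(y0 + y1 - y2 + y3) / 2|.

Definition vec (y0 y1 y2 y3 : R) : X :=
  y0 *: e`_0 + y1 *: e`_1 + y2 *: e`_2 + y3 *: e`_3.

Lemma vec_coord x : x = vec (c 0 x) (c 1 x) (c 2 x) (c 3 x).
Proof. by rewrite {1}(coord_basis e_basis (memvf x)) big_ord4 !inordK. Qed.

Lemma sum_vec (y : 'I_4 -> R) : \sum_i y i *: e`_i =
  vec (y (inord 0)) (y (inord 1)) (y (inord 2)) (y (inord 3)).
Proof. by rewrite big_ord4 !inordK. Qed.

Lemma coord_vec y0 y1 y2 y3 : let x := vec y0 y1 y2 y3 in
  [/\ c 0 x = y0, c 1 x = y1, c 2 x = y2 & c 3 x = y3].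
Proof.
have fe := basis_free e_basis.
pose y (i : 'I_4) := nth 0 [:: y0; y1; y2; y3] i.
have -> : vec y0 y1 y2 y3 = \sum_i y i *: e`_i by rewrite sum_vec /y !inordK.
by split; rewrite coord_sum_free// /y inordK.
Qed.

(** By homogeneity the infimum runs over the [t > 0] with [n <= t]. It is not attained when [n = 0],
    hence the approximation by [eps]. *)
Lemma minkowski_crosspolytope x :
  minkowski_functional (crosspolytope e) x =
  cross_norm (c 0 x) (c 1 x) (c 2 x) (c 3 x).
Proof.
set n := cross_norm _ _ _ _.
have n0 : 0 <= n by rewrite !addr_ge0.
have scale t y0 y1 y2 y3 : 0 <= t ->
    cross_norm (t * y0) (t * y1) (t * y2) (t * y3) = t * cross_norm y0 y1 y2 y3.
  move=> t0; rewrite /cross_norm -!mulrDr -!mulrBr -!mulrDr -!mulrA !normrM.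
  by rewrite (ger0_norm t0) !mulrDr.
rewrite /minkowski_functional.
have -> : [set t : R | 0 < t /\ exists2 y, crosspolytope e y & x = t *: y] =
    [set t | 0 < t /\ n <= t].
  apply/seteqP; split => t /= [t0].
    move=> [_ [y [-> Ly]] xE]; split => //.
    rewrite /n xE sum_vec !linearZ /=.
    have [-> -> -> ->] := coord_vec (y (inord 0)) (y (inord 1)) (y (inord 2)) (y (inord 3)).
    by rewrite (scale _ _ _ _ _ (ltW t0)) -[leRHS]mulr1 ler_pM2l.
  move=> nt; split => //; exists (t^-1 *: x); last first.
    by rewrite scalerA divff ?gt_eqF// scale1r.
  exists (fun i => t^-1 * coord e i x); split.
    rewrite {1}(coord_basis e_basis (memvf x)) scaler_sumr.
    by apply: eq_bigr => i _; rewrite scalerA.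
  suff : cross_norm (t^-1 * c 0 x) (t^-1 * c 1 x) (t^-1 * c 2 x) (t^-1 * c 3 x) <= 1 by [].
  have ti : 0 <= t^-1 by rewrite invr_ge0 ltW.
  rewrite (scale _ _ _ _ _ ti).
  by rewrite mulrC ler_pdivrMr// mul1r.
apply/eqP; rewrite eq_le; apply/andP; split.
  apply/ler_addgt0Pr => eps eps0; apply: ge_inf.
    by exists n => t [].
  by split; [rewrite ltr_wpDl|rewrite lerDl ltW].
apply: lb_le_inf => [|t []//].
by exists (n + 1); split; [rewrite ltr_wpDl|rewrite lerDl].
Qed.

Local Notation N := (minkowski_functional (crosspolytope e)).

Lemma crosspolytope_normD x y : N (x + y) <= N x + N y.
Proof.
rewrite !minkowski_crosspolytope /cross_norm !linearD /=.
set t1 := `|(c 0 x + _ + _) / s|.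
have tri (u v w : R) : w = u + v -> `|w| <= `|u| + `|v| by move=> ->; exact: ler_normD.
rewrite (_ : _ + _ + _ + _ + (_ + _ + _ + _) = 
  (`|(c 0 x + c 2 x) / s| + `|(c 0 y + c 2 y) / s|) +
  (`|(c 1 x - c 3 x) / s| + `|(c 1 y - c 3 y) / s|) +
  (`|(c 0 x - c 1 x - c 2 x - c 3 x) / 2| + `|(c 0 y - c 1 y - c 2 y - c 3 y) / 2|) +
  (`|(c 0 x + c 1 x - c 2 x + c 3 x) / 2| + `|(c 0 y + c 1 y - c 2 y + c 3 y) / 2|)); last by ring.
by rewrite /t1; apply: lerD; [apply: lerD; [apply: lerD|]|]; apply: tri; ring.
Qed.

Lemma crosspolytope_normZ k x : N (k *: x) = `|k| * N x.
Proof.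
rewrite !minkowski_crosspolytope /cross_norm !linearZ /= !mulrDr -!normrM.
by congr (_ + _ + _ + _); congr (`|_|); rewrite /GRing.scale /=; ring.
Qed.

Lemma ip_coord x : ip x x = c 0 x ^+ 2 + c 1 x ^+ 2 + c 2 x ^+ 2 + c 3 x ^+ 2.
Proof.
have eE : tval e = [:: e`_0; e`_1; e`_2; e`_3].
  by case: (e) => -[|x0 [|x1 [|x2 [|x3 [|? ?]]]]].
have ipC u v : ip u v = ip v u by rewrite hermC expr0 mul1r.
move: e_orthonormal; rewrite /orthonormal eE /= !andbT -!andbA.
case/and5P => /eqP n0 /eqP n1 /eqP n2 /eqP n3.
case/and5P => /eqP o01 /eqP o02 /eqP o03 /eqP o12 /andP[/eqP o13 /eqP o23].
rewrite {1 2}(vec_coord x) /vec !linearDl !linearDr /=.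
rewrite !linearZl_LR !linearZr_LR /= /GRing.scale /=.
rewrite (ipC e`_1 e`_0) (ipC e`_2 e`_0) (ipC e`_3 e`_0).
rewrite (ipC e`_2 e`_1) (ipC e`_3 e`_1) (ipC e`_3 e`_2).
rewrite n0 n1 n2 n3 o01 o02 o03 o12 o13 o23; ring.
Qed.

(** The four functionals are orthonormal, so this is the Cauchy-Schwarz inequality between the sum
    of four numbers and the sum of their squares. *)
Lemma crosspolytope_norm_ip x : N x ^+ 2 <= 4 * ip x x.
Proof.
rewrite minkowski_crosspolytope ip_coord /cross_norm.
set y0 := c 0 x; set y1 := c 1 x; set y2 := c 2 x; set y3 := c 3 x.
have s2 := @sqr_sqrt2 R.
have -> : y0 ^+ 2 + y1 ^+ 2 + y2 ^+ 2 + y3 ^+ 2 =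
    ((y0 + y2) / s) ^+ 2 + ((y1 - y3) / s) ^+ 2 +
    ((y0 - y1 - y2 - y3) / 2) ^+ 2 + ((y0 + y1 - y2 + y3) / 2) ^+ 2.
  by rewrite invr_sqrt2; field: s2.
rewrite -(real_normK (num_real ((y0 + y2) / s))) -(real_normK (num_real ((y1 - y3) / s))).
rewrite -(real_normK (num_real ((y0 - y1 - y2 - y3) / 2))).
rewrite -(real_normK (num_real ((y0 + y1 - y2 + y3) / 2))).
set a := `| _ / s|; set b := `|_ / s|; set d := `|_ / 2|; set f := `|_ / 2|.
have := sqr_ge0 (a - b); have := sqr_ge0 (a - d); have := sqr_ge0 (a - f).
have := sqr_ge0 (b - d); have := sqr_ge0 (b - f); have := sqr_ge0 (d - f).
by lra.
Qed.

End crosspolytope.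

Section dual_basis.
Context {R : realType} {X : vectType R} (e : 4.-tuple X).
Hypothesis e_basis : basis_of fullv e.
Local Notation s := (Num.sqrt 2 : R).
Local Notation N := (minkowski_functional (crosspolytope e)).
Local Notation c k x := (coord e (inord k) x).

(* The vector at which the four functionals defining the crosspolytope take the
   values u1, ..., u4. *)
Definition dual (u1 u2 u3 u4 : R) : X :=
  vec e (s / 2 * u1 + (u3 + u4) / 2) (s / 2 * u2 + (u4 - u3) / 2)
    (s / 2 * u1 - (u3 + u4) / 2) ((u4 - u3) / 2 - s / 2 * u2).

Lemma coord_dual u1 u2 u3 u4 : let x := dual u1 u2 u3 u4 in
  [/\ c 0 x = s / 2 * u1 + (u3 + u4) / 2, c 1 x = s / 2 * u2 + (u4 - u3) / 2,
      c 2 x = s / 2 * u1 - (u3 + u4) / 2 & c 3 x = (u4 - u3) / 2 - s / 2 * u2].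
Proof. exact: coord_vec. Qed.

Lemma norm_dual (x y u1 u2 u3 u4 w1 w2 w3 w4 : R) :
  N (x *: dual u1 u2 u3 u4 + y *: dual w1 w2 w3 w4) =
  `|x * u1 + y * w1| + `|x * u2 + y * w2| + `|x * u3 + y * w3| +
  `|x * u4 + y * w4|.
Proof.
have s2 := @sqr_sqrt2 R.
have L k (v w : X) : c k (x *: v + y *: w) = x * c k v + y * c k w.
  by rewrite linearD !linearZ.
rewrite minkowski_crosspolytope// !L.
have [-> -> -> ->] := coord_dual u1 u2 u3 u4.
have [-> -> -> ->] := coord_dual w1 w2 w3 w4.
rewrite /cross_norm invr_sqrt2.
by congr (_ + _ + _ + _); congr (`|_|); field: s2.
Qed.

End dual_basis.

(** * Contractions onto the plane of the first two basis vectors *)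

Section projection.
Context {R : realType} {X : vectType R} (ip : {dot X for idfun}) (e : 4.-tuple X).
Hypothesis e_basis : basis_of fullv e.
Hypothesis e_orthonormal : orthonormal ip e.
Local Notation s := (Num.sqrt 2 : R).
Local Notation N := (minkowski_functional (crosspolytope e)).
Local Notation c k x := (coord e (inord k) x).
Variable p : 'End(X).
Hypothesis p_contraction : linear_contraction ip N <<[:: e`_0; e`_1]>>%VS p.

Lemma projection_mem x : exists y0 y1, p x = vec e y0 y1 0 0.
Proof.
have [_ pW _] := p_contraction.
have : p x \in limg p by rewrite memv_img// memvf.
rewrite pW span_cons span_seq1 => /memv_addP[_ /vlineP[k1 ->] [_ /vlineP[k2 ->] ->]].
by exists k1, k2; rewrite /vec !scale0r !addr0.
Qed.

Lemma projection_fix x : x \in <<[:: e`_0; e`_1]>>%VS -> p x = x.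
Proof.
have [pp pW _] := p_contraction; rewrite -pW => /memv_imgP[u _ ->].
by rewrite -comp_lfunE pp.
Qed.

(** A projection onto the plane fixes its two basis vectors, so only the images of the other two,
    four real numbers, are free. *)
Lemma coord_projection x :
  [/\ c 0 (p x) = c 0 x + c 2 x * c 0 (p e`_2) + c 3 x * c 0 (p e`_3),
      c 1 (p x) = c 1 x + c 2 x * c 1 (p e`_2) + c 3 x * c 1 (p e`_3),
      c 2 (p x) = 0 & c 3 (p x) = 0].
Proof.
have e0 : e`_0 = vec e 1 0 0 0 by rewrite /vec scale1r !scale0r !addr0.
have e1 : e`_1 = vec e 0 1 0 0 by rewrite /vec scale1r !scale0r add0r !addr0.
have p0 : p e`_0 = e`_0 by apply: projection_fix; rewrite memv_span// !inE eqxx.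
have p1 : p e`_1 = e`_1 by apply: projection_fix; rewrite memv_span// !inE eqxx orbT.
have [y0 [y1 pxE]] := projection_mem x.
have [_ _ c2 c3] := coord_vec e_basis y0 y1 0 0.
have [a0 a1 _ _] := coord_vec e_basis 1 0 0 0.
have [b0 b1 _ _] := coord_vec e_basis 0 1 0 0.
split; last 2 first.
- by rewrite pxE.
- by rewrite pxE.
- rewrite {1}(vec_coord e_basis x) /vec !linearD !linearZ /= p0 p1.
  by rewrite e0 e1 a0 b0 /GRing.scale /= mulr1 mulr0 addr0.
- rewrite {1}(vec_coord e_basis x) /vec !linearD !linearZ /= p0 p1.
  by rewrite e0 e1 a1 b1 /GRing.scale /= mulr1 mulr0 add0r.
Qed.

Lemma projection_det_le v1 v2 :
  (forall x y : R, exists i j : int,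
    N ((x - i%:~R) *: v1 + (y - j%:~R) *: v2) <= 1) ->
  (forall x y : R, Num.max `|x| `|y| <= 2 * N (x *: v1 + y *: v2)) ->
  `|c 0 (p v1) * c 1 (p v2) - c 0 (p v2) * c 1 (p v1)| <= 12 * s - 16.
Proof.
move=> tiles coercive.
have s2 := @sqr_sqrt2 R; have /andP[s1 _] := @sqrt2_bounds R.
have s0 : 0 <= s by lra.
have [_ _ contr] := p_contraction.
(* Outer normals of the octagon: its sides are h1 = 1, h2 = 1,
   (h1 + h2) / sqrt 2 = 1, (h1 - h2) / sqrt 2 = 1 and their opposites. *)
pose h1 x := (1 + s / 2) * c 0 x + s / 2 * c 1 x.
pose h2 x := - (s / 2) * c 0 x + (1 + s / 2) * c 1 x.
have h_le x : [/\ h1 (p x) <= N (p x), h2 (p x) <= N (p x),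
    h1 (p x) + h2 (p x) <= s * N (p x) & h1 (p x) - h2 (p x) <= s * N (p x)].
  have [_ _ c2 c3] := coord_projection x.
  rewrite /h1 /h2 minkowski_crosspolytope// c2 c3 /cross_norm !subr0 !addr0.
  set y0 := c 0 (p x); set y1 := c 1 (p x).
  have abs (u : R) : - `|u| <= u <= `|u| by rewrite -ler_norml.
  have /andP[a0 a1] := abs y0; have /andP[b0 b1] := abs y1.
  have /andP[d0 d1] := abs (y0 - y1); have /andP[f0 f1] := abs (y0 + y1).
  rewrite !normrM !(ger0_norm (_ : 0 <= s^-1)) ?invr_ge0// invr_sqrt2.
  rewrite [`|2^-1|]ger0_norm//.
  set A := `|y0| in a0 a1 *; set B := `|y1| in b0 b1 *.
  set D := `|y0 - y1| in d0 d1 *; set F := `|y0 + y1| in f0 f1 *.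
  have sN : s * (A * (s / 2) + B * (s / 2) + D / 2 + F / 2) =
    A + B + s * ((D + F) / 2) by field: s2.
  rewrite sN.
  (* Products with [s] that linear arithmetic cannot form by itself. *)
  have k1 : 0 <= s * ((A - y0) + (B - y1)) by apply: mulr_ge0; lra.
  have k2 : 0 <= s * ((A + y0) + (B - y1)) by apply: mulr_ge0; lra.
  have k3 : 0 <= s * (D + F - 2 * y1) by apply: mulr_ge0; lra.
  have k4 : 0 <= s * (D + F - 2 * y0) by apply: mulr_ge0; lra.
  by split; lra.
have := plane_det_le (crosspolytope_normD e_basis) (crosspolytope_normZ e_basis)
  (crosspolytope_norm_ip e_basis e_orthonormal) (ler0n R 2) tiles coercive contr
  _ _ _ _ h_le.
(* The factor [2 + s] is the determinant of [(h1, h2)] in the coordinates of the plane. *)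
rewrite (_ : h1 (p v1) * h2 (p v2) - _ = (2 + s) *
  (c 0 (p v1) * c 1 (p v2) - c 0 (p v2) * c 1 (p v1))); last first.
  by rewrite /h1 /h2; field: s2.
rewrite normrM gtr0_norm; last by lra.
have -> : 8 * (s - 1) = (2 + s) * (12 * s - 16) by ring: s2.
rewrite ler_pM2l; last by lra.
by apply; move=> *; rewrite /h1 /h2 !(linearD, linearZ) /= /GRing.scale /=; ring.
Qed.

Lemma square_det_le (u1 u2 u3 u4 w1 w2 w3 w4 : R) :
  (forall x y, `|x * u1 + y * w1| + `|x * u2 + y * w2| + `|x * u3 + y * w3| +
    `|x * u4 + y * w4| = `|x + y| + `|x - y|) ->
  let v1 := dual e u1 u2 u3 u4 in let v2 := dual e w1 w2 w3 w4 in
  `|c 0 (p v1) * c 1 (p v2) - c 0 (p v2) * c 1 (p v1)| <= 12 * s - 16.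
Proof.
move=> H; apply: projection_det_le => x y.
  have [i [j ij]] := square_tiling x y.
  by exists i, j; rewrite norm_dual// H.
rewrite norm_dual// H ge_max.
by case: (ger0P x) => ?; case: (ger0P y) => ?; case: (ger0P (x + y)) => ?;
  case: (ger0P (x - y)) => ?; apply/andP; split; lra.
Qed.

Lemma hexagon_det_le (u1 u2 u3 u4 w1 w2 w3 w4 : R) :
  (forall x y, `|x * u1 + y * w1| + `|x * u2 + y * w2| + `|x * u3 + y * w3| +
    `|x * u4 + y * w4| = hexnorm x y) ->
  let v1 := dual e u1 u2 u3 u4 in let v2 := dual e w1 w2 w3 w4 in
  `|c 0 (p v1) * c 1 (p v2) - c 0 (p v2) * c 1 (p v1)| <= 12 * s - 16.
Proof.
move=> H; apply: projection_det_le => x y.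
  have [i [j ij]] := hexagon_tiling x y.
  by exists i, j; rewrite norm_dual// H.
by rewrite norm_dual// H; exact: hexnorm_coercive.
Qed.

Lemma contraction_absurd : False.
Proof.
have s2 := @sqr_sqrt2 R.
(* The matrix of [p] on the last two basis vectors; its entry [q] is called [c] in
   [sqrt2_contradiction]. *)
set a := c 0 (p e`_2); set b := c 0 (p e`_3).
set q := c 1 (p e`_2); set d := c 1 (p e`_3).
have pE u1 u2 u3 u4 : let v := dual e u1 u2 u3 u4 in
    c 0 (p v) = s / 2 * u1 + (u3 + u4) / 2 + (s / 2 * u1 - (u3 + u4) / 2) * a +
      ((u4 - u3) / 2 - s / 2 * u2) * b /\
    c 1 (p v) = s / 2 * u2 + (u4 - u3) / 2 + (s / 2 * u1 - (u3 + u4) / 2) * q +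
      ((u4 - u3) / 2 - s / 2 * u2) * d.
  move=> v; have [-> -> _ _] := coord_projection v.
  by have [-> -> -> ->] := coord_dual e_basis u1 u2 u3 u4.
have det u1 u2 u3 u4 w1 w2 w3 w4 E : let v1 := dual e u1 u2 u3 u4 in
    let v2 := dual e w1 w2 w3 w4 in
    `|c 0 (p v1) * c 1 (p v2) - c 0 (p v2) * c 1 (p v1)| <= 12 * s - 16 ->
    (c 0 (p v1) * c 1 (p v2) - c 0 (p v2) * c 1 (p v1)) = - E -> `|E| <= 12 * s - 16.
  by move=> v1 v2 h hE; rewrite hE normrN in h.
have n0 (x y : R) : `|x * 0 + y * 0| = 0 by rewrite !mulr0 addr0 normr0.
pose A : R := 5 / 2 - s; pose B : R := s - 1.
apply: (@sqrt2_contradiction R a b q d).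
(* Here and in the next case, a plane where two of the functionals vanish and the unit ball is a
   square. *)
- apply: (det 1 1 0 0 1 (-1) 0 0).
    by apply: square_det_le => x y; rewrite !n0 !addr0 !mulr1 mulrN1.
  by have [-> ->] := pE 1 1 0 0; have [-> ->] := pE 1 (-1) 0 0; field: s2.
- apply: (det 0 0 1 1 0 0 1 (-1)).
    by apply: square_det_le => x y; rewrite !n0 !add0r !mulr1 mulrN1.
  by have [-> ->] := pE 0 0 1 1; have [-> ->] := pE 0 0 1 (-1); field: s2.
(* The isometry [T : (u1, u2, u3, u4) -> (u3, u4, -u2, u1)] of the l^1 norm acts on the target plane
   as a rotation by [pi / 4], and [T^4 = -1]. Up to sign, this pair of vectors and the three below
   are the images of this one under [1], [T^2], [T] and [T^3]. *)
- apply: (det (1 / 2) A (- B) 0 A (1 / 2) B 0).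
    apply: hexagon_det_le => x y; rewrite n0 ?addr0 ?add0r /hexnorm.
    rewrite (_ : x * (1 / 2) + y * A = x / 2 + (5 / 2 - s) * y); last by rewrite /A /B; field.
    rewrite (_ : x * A + y * (1 / 2) = (5 / 2 - s) * x + y / 2); last by rewrite /A /B; field.
    rewrite (_ : x * (- B) + y * B = - ((s - 1) * (x - y))); last by rewrite /A /B; field.
    by rewrite ?normrN; ring.
  have [-> ->] := pE (1 / 2) A (- B) 0; have [-> ->] := pE A (1 / 2) B 0.
  by rewrite /A /B; field: s2.
- apply: (det (- A) (1 / 2) 0 (- B) (- (1 / 2)) A 0 B).
    apply: hexagon_det_le => x y; rewrite n0 ?addr0 ?add0r /hexnorm.
    rewrite (_ : x * (- A) + y * (- (1 / 2)) = - ((5 / 2 - s) * x + y / 2));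
      last by rewrite /A /B; field.
    rewrite (_ : x * (1 / 2) + y * A = x / 2 + (5 / 2 - s) * y); last by rewrite /A /B; field.
    rewrite (_ : x * (- B) + y * B = - ((s - 1) * (x - y))); last by rewrite /A /B; field.
    by rewrite ?normrN; ring.
  have [-> ->] := pE (- A) (1 / 2) 0 (- B); have [-> ->] := pE (- (1 / 2)) A 0 B.
  by rewrite /A /B; field: s2.
- apply: (det (- B) 0 (- A) (1 / 2) B 0 (- (1 / 2)) A).
    apply: hexagon_det_le => x y; rewrite n0 ?addr0 ?add0r /hexnorm.
    rewrite (_ : x * (- B) + y * B = - ((s - 1) * (x - y))); last by rewrite /A /B; field.
    rewrite (_ : x * (- A) + y * (- (1 / 2)) = - ((5 / 2 - s) * x + y / 2));
      last by rewrite /A /B; field.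
    rewrite (_ : x * (1 / 2) + y * A = x / 2 + (5 / 2 - s) * y); last by rewrite /A /B; field.
    by rewrite ?normrN; ring.
  have [-> ->] := pE (- B) 0 (- A) (1 / 2); have [-> ->] := pE B 0 (- (1 / 2)) A.
  by rewrite /A /B; field: s2.
- apply: (det 0 B (1 / 2) A 0 (- B) A (1 / 2)).
    apply: hexagon_det_le => x y; rewrite n0 ?addr0 ?add0r /hexnorm.
    rewrite (_ : x * B + y * (- B) = (s - 1) * (x - y)); last by rewrite /A /B; field.
    rewrite (_ : x * (1 / 2) + y * A = x / 2 + (5 / 2 - s) * y); last by rewrite /A /B; field.
    rewrite (_ : x * A + y * (1 / 2) = (5 / 2 - s) * x + y / 2); last by rewrite /A /B; field.
    by rewrite ?normrN; ring.
  have [-> ->] := pE 0 B (1 / 2) A; have [-> ->] := pE 0 (- B) A (1 / 2).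
  by rewrite /A /B; field: s2.
Qed.

End projection.

Theorem theorem1 (R : realType) (X : vectType R) (ip : {dot X for idfun})
    (e : 4.-tuple X) (dimX : \dim (fullv : {vspace X}) = 4%N)
    (e_basis : basis_of fullv e) (e_orthonormal : orthonormal ip e) :
  ~ exists p : 'End(X),
      linear_contraction ip (minkowski_functional (crosspolytope e))
        <<[:: e`_0; e`_1]>>%VS p.
Proof. by move=> [p pc]; exact: contraction_absurd pc. Qed.
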